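(* Let $\mathcal{A}$ and $\mathcal{B}$ be Banach algebras such that $\mathcal{A}\widehat{\otimes}\mathcal{B}$ is approximately weakly amenable. (i) Then both $\mathcal{A}$ and $\mathcal{B}$ are essential. (ii) If $\varphi\in\Phi_{\mathcal{A}}$ and $\psi\in\Phi_{\mathcal{B}}$, then there are no non-zero point derivations on both $\mathcal{A}$ and $\mathcal{B}$ (that is, none on $\mathcal{A}$ and none on $\mathcal{B}$). (iii) If $\mathcal{A}\widehat{\otimes}\mathcal{A}$ is approximately weakly amenable, then $\mathcal{A}$ is essential and there is no non-zero point derivation on $\mathcal{A}$.
   Context: $\widehat{\otimes}$ is the projective tensor product (with its usual Banach algebra structure). For a Banach algebra $\mathcal{C}$, the dual $\mathcal{C}^*$ is a Banach $\mathcal{C}$-bimodule via $\langle a\cdot f,b\rangle=\langle f,ba\rangle$, $\langle f\cdot a,b\rangle=\langle f,ab\rangle$. A derivation $D:\mathcal{C}\to\mathcal{C}^*$ is a bounded linear map with $D(ab)=D(a)\cdot b+a\cdot D(b)$ for all $a,b\in\mathcal{C}$. It is approximately inner if there is a net $(x_i)$ in $\mathcal{C}^*$ with $D(a)=\lim_i(a\cdot x_i-x_i\cdot a)$ in norm for every $a\in\mathcal{C}$. $\mathcal{C}$ is approximately weakly amenable if every derivation $D:\mathcal{C}\to\mathcal{C}^*$ is approximately inner. $\mathcal{C}$ is essential if $\mathcal{C}^2$ (the linear span of the products $ab$, $a,b\in\mathcal{C}$) is dense in $\mathcal{C}$. A character on $\mathcal{C}$ is a non-zero homomorphism $\mathcal{C}\to\mathbb{C}$,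 and $\Phi_{\mathcal{C}}$ is the set of characters on $\mathcal{C}$. A linear functional $d$ on $\mathcal{C}$ is a point derivation at $\varphi\in\Phi_{\mathcal{C}}$ if $d(ab)=\varphi(a)d(b)+\varphi(b)d(a)$ for all $a,b\in\mathcal{C}$; a point derivation on $\mathcal{C}$ is a point derivation at some character of $\mathcal{C}$.
   Formalization: Point derivations in (ii) and (iii) are taken continuous (the claim fails for discontinuous ones, e.g. on the unitization of l^2), and (i) assumes A and B are both non-zero (if B = 0 the tensor product is 0 and A can be arbitrary). *)

(* Defs.v *)
From HB Require Import structures.
From mathcomp Require Import all_boot all_order all_algebra.
From mathcomp Require Import all_classical all_reals all_analysis.
From mathcomp Require Import complex.

Set Implicit Arguments.
Unset Strict Implicit.
Unset Printing Implicit Defensive.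

Import Order.TTheory GRing.Theory Num.Theory.
Import numFieldNormedType.Exports.

Local Open Scope classical_set_scope.
Local Open Scope ring_scope.
Local Open Scope complex_scope.

Declare Scope banach_scope.
Delimit Scope banach_scope with B.
Local Open Scope banach_scope.

(* The rings of the library are unital; Banach algebras are not assumed to be,
   so the multiplication is a separate operation. *)
HB.mixin Record CompleteNormedModule_isBanachAlgebra (K : numFieldType) A
    & CompleteNormedModule K A := {
  amul : A -> A -> A ;
  amulA : associative amul ;
  amul_bilinear : bilinear_for *:%R *:%R amul ;
  ler_norm_amul : forall a b, `|amul a b| <= `|a| * `|b|
}.

#[short(type="banachAlgType")]
HB.structure Definition BanachAlgebra (K : numFieldType) :=
  {A of CompleteNormedModule K A & CompleteNormedModule_isBanachAlgebra K A}.

Notation "a ** b" := (amul a b) (at level 40, left associativity) : banach_scope.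

(* The norm of a normed space over R[i] takes its values in R[i]; they are real. *)
Lemma Re_norm (R : realType) (W : normedModType R[i]) (w : W) :
  (complex.Re `|w|)%:C = `|w|.
Proof.
by have := normr_ge0 w; case: `|w| => a b; rewrite lecE /= => /andP[/eqP->].
Qed.

Section Dual.
Variables (R : realType) (V : normedModType R[i]).

Definition dual_pred : {pred V -> R[i]^o} :=
  mem [set f | linear f /\ exists M : R, forall v, `|f v| <= M%:C * `|v|].

Lemma dual_submod_closed : submod_closed dual_pred.
Proof.
split.
  rewrite inE; split; first by move=> k x y; rewrite /= scaler0 addr0.
  by exists 0 => v; rewrite normr0 mul0r.
move=> k f g; rewrite !inE => -[lf [M Mf]] [lg [N Ng]]; split.
  move=> c x y; rewrite !fctE lf lg !scalerDr !scalerA mulrC.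
  by rewrite !addrA; congr (_ + _); rewrite -!addrA; congr (_ + _); rewrite addrC.
exists (complex.Re `|k| * M + N) => v; rewrite !fctE rmorphD rmorphM mulrDl.
rewrite (_ : _%:C * _%:C = `|k| * M%:C); last first.
  by congr (_ * _); exact: (Re_norm (k : R[i]^o)).
apply: (le_trans (ler_normD _ _)); rewrite lerD// normrZ -mulrA.
by rewrite ler_wpM2l.
Qed.

HB.instance Definition _ :=
  GRing.isSubmodClosed.Build R[i] _ dual_pred dual_submod_closed.

(* The topological dual of V, as a space of functions. *)
Record dual := Dual { dual_fun :> V -> R[i]^o ; _ : dual_fun \in dual_pred }.

HB.instance Definition _ := [isSub for dual_fun].
HB.instance Definition _ := [Choice of dual by <:].
HB.instance Definition _ := [SubChoice_isSubLmodule of dual by <:].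

Lemma dual_linear (f : dual) : linear f.
Proof. by case: f => f /=; rewrite inE => -[]. Qed.

HB.instance Definition _ (f : dual) :=
  GRing.isLinear.Build R[i] V R[i]^o _ f (dual_linear f).

Lemma dual_bounded (f : dual) : exists M : R, forall v, `|f v| <= M%:C * `|v|.
Proof. by case: f => f /=; rewrite inE => -[]. Qed.

Definition dual_norm (f : dual) : R :=
  sup [set complex.Re `|f v| | v in [set v | `|v| <= 1]].

Lemma dual_norm_has_sup (f : dual) :
  has_sup [set complex.Re `|f v| | v in [set v | `|v| <= 1]].
Proof.
split; first by exists (complex.Re `|f 0|), 0 => //=; rewrite normr0.
have [M fM] := dual_bounded f; exists `|M| => _ [v v1 <-].
have {}v1 : `|v| <= 1 by [].
rewrite -lecR Re_norm (le_trans (fM v))//.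
rewrite -(Re_norm v) -rmorphM lecR.
have v1' : complex.Re `|v| <= 1 by rewrite -lecR Re_norm.
have v0 : 0 <= complex.Re `|v| by rewrite -lecR Re_norm normr_ge0.
by rewrite (le_trans (ler_norm _))// normrM (ger0_norm v0) ler_piMr.
Qed.

Lemma le_dual_norm (f : dual) v : `|f v| <= (dual_norm f)%:C * `|v|.
Proof.
have [->|v0] := eqVneq v 0; first by rewrite linear0 !normr0 mulr0.
have nv : 0 < `|v| by rewrite normr_gt0.
rewrite -ler_pdivrMr// mulrC.
have -> : `|v|^-1 * `|f v| = `|f (`|v|^-1 *: v)|.
  by rewrite linearZ normrZ normfV normr_id.
rewrite -[X in X <= _]Re_norm lecR; apply: ub_le_sup.
  by case: (dual_norm_has_sup f).
by exists (`|v|^-1 *: v) => //=; rewrite normrZ normfV normr_id mulVf ?gt_eqF.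
Qed.

Lemma dual_norm_le (f : dual) (M : R) :
  (forall v, `|v| <= 1 -> `|f v| <= M%:C) -> dual_norm f <= M.
Proof.
move=> fM; apply: ge_sup; first by case: (dual_norm_has_sup f).
by move=> _ [v v1 <-]; rewrite -lecR Re_norm fM.
Qed.

Lemma dual_norm_ge0 (f : dual) : 0 <= dual_norm f.
Proof.
apply: (@le_trans _ _ (complex.Re `|f 0|)).
  by rewrite -lecR Re_norm normr_ge0.
apply: ub_le_sup; first by case: (dual_norm_has_sup f).
by exists 0; rewrite //= normr0.
Qed.

Let ler_dual_normD (f g : dual) :
  (dual_norm (f + g))%:C <= (dual_norm f)%:C + (dual_norm g)%:C.
Proof.
rewrite -rmorphD lecR; apply: dual_norm_le => v v1.
rewrite (le_trans (ler_normD (f v) (g v)))// rmorphD lerD//.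
  by rewrite (le_trans (le_dual_norm f v))// ler_piMr// lecR dual_norm_ge0.
by rewrite (le_trans (le_dual_norm g v))// ler_piMr// lecR dual_norm_ge0.
Qed.

Let dual_normZ_le (k : R[i]) (f : dual) :
  (dual_norm (k *: f))%:C <= `|k| * (dual_norm f)%:C.
Proof.
have Rek : (complex.Re `|k|)%:C = `|k| := Re_norm (k : R[i]^o).
rewrite -Rek -rmorphM lecR; apply: dual_norm_le => v v1.
rewrite rmorphM /= Rek.
have -> : `|(k *: f) v| = `|k| * `|f v| by rewrite -normrZ.
rewrite ler_wpM2l//.
by rewrite (le_trans (le_dual_norm f v))// ler_piMr// lecR dual_norm_ge0.
Qed.

Let dual_normZ (k : R[i]) (f : dual) :
  (dual_norm (k *: f))%:C = `|k| * (dual_norm f)%:C.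
Proof.
apply/eqP; rewrite eq_le dual_normZ_le /=.
have [->|k0] := eqVneq k 0; first by rewrite normr0 mul0r lecR dual_norm_ge0.
have := dual_normZ_le k^-1 (k *: f).
by rewrite scalerA mulVf// scale1r normfV ler_pdivlMl// normr_gt0.
Qed.

Let dual_norm_eq0 (f : dual) : (dual_norm f)%:C = 0 -> f = 0.
Proof.
move=> f0; apply/val_inj/funext => v; apply/eqP; rewrite -normr_le0.
by rewrite (le_trans (le_dual_norm f v))// f0 mul0r.
Qed.

HB.instance Definition _ := Lmodule_isNormed.Build R[i] dual
  ler_dual_normD dual_normZ dual_norm_eq0.

End Dual.

Section BanachAlgebraTheory.
Variables (R : realType) (A : banachAlgType R[i]).

Lemma amul_linearl (b : A) : linear (amul^~ b : A -> A).
Proof. by move=> k x y; rewrite (fst amul_bilinear b k x y). Qed.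

Lemma amul_linearr (a : A) : linear (amul a : A -> A).
Proof. by move=> k x y; rewrite (snd amul_bilinear a k x y). Qed.

HB.instance Definition _ := bilinear_isBilinear.Build R[i] A A A *:%R *:%R
  (@amul R[i] A) amul_bilinear.

Definition square : set A :=
  [set x | exists n (k : 'I_n -> R[i]) (a b : 'I_n -> A),
     x = \sum_(i < n) k i *: (a i ** b i)].

Definition essential := dense square.

Lemma lact_subproof (a : A) (f : dual A) :
  (fun b => f (b ** a) : R[i]^o) \in @dual_pred R A.
Proof.
rewrite inE; split; first by move=> k x y; rewrite amul_linearl linearP.
exists (dual_norm f * complex.Re `|a|) => b.
rewrite rmorphM /= Re_norm (le_trans (le_dual_norm f _))// -mulrA.
by rewrite ler_wpM2l ?lecR ?dual_norm_ge0// mulrC ler_norm_amul.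
Qed.

Lemma ract_subproof (f : dual A) (a : A) :
  (fun b => f (a ** b) : R[i]^o) \in @dual_pred R A.
Proof.
rewrite inE; split; first by move=> k x y; rewrite amul_linearr linearP.
exists (dual_norm f * complex.Re `|a|) => b.
rewrite rmorphM /= Re_norm (le_trans (le_dual_norm f _))// -mulrA.
by rewrite ler_wpM2l ?lecR ?dual_norm_ge0// ler_norm_amul.
Qed.

(* The module actions a . f and f . a of A on its dual. *)
Definition lact (a : A) (f : dual A) : dual A := Dual (lact_subproof a f).
Definition ract (f : dual A) (a : A) : dual A := Dual (ract_subproof f a).

Definition derivation (D : {linear A -> dual A}) :=
  continuous D /\ forall a b, D (a ** b) = ract (D a) b + lact a (D b).

Definition directed (I : Type) (le : I -> I -> Prop) :=
  [/\ inhabited I,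
      forall i, le i i,
      forall i j k, le i j -> le j k -> le i k &
      forall i j, exists k, le i k /\ le j k].

Definition tails (I : Type) (le : I -> I -> Prop) : set_system I :=
  filter_from setT (fun i => [set j | le i j]).

Definition approximately_inner (D : {linear A -> dual A}) :=
  exists (I : Type) (le : I -> I -> Prop) (x : I -> dual A),
    directed le /\
    forall a, lact a (x i) - ract (x i) a @[i --> tails le] --> D a.

Definition approximately_weakly_amenable :=
  forall D : {linear A -> dual A}, derivation D -> approximately_inner D.

Definition character (phi : {scalar A}) :=
  (exists a, phi a != 0) /\ forall a b, phi (a ** b) = phi a * phi b.

Definition point_derivation_at (phi d : {scalar A}) :=
  forall a b, d (a ** b) = phi a * d b + phi b * d a.

(* Continuity has to be required: on the unitization of l^2 (pointwise product)
   there are discontinuous point derivations, although that algebra and its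
   projective tensor square are weakly amenable. *)
Definition no_nonzero_continuous_point_derivation :=
  ~ exists phi d : {scalar A},
      [/\ character phi, point_derivation_at phi d,
          continuous (d : A -> R[i]^o) & exists a, d a != 0].

End BanachAlgebraTheory.

Arguments essential {R} A.
Arguments approximately_weakly_amenable {R} A.
Arguments no_nonzero_continuous_point_derivation {R} A.

Section ProjectiveTensorProduct.
Variables (R : realType) (A B : banachAlgType R[i]).

(* A sequence of pairs stands for the formal sum of the a (x) b; tensor_sum beta
   is its image under the linear map induced by the bilinear map beta. *)
Definition tensor_sum (V : lmodType R[i]) (beta : A -> B -> V)
    (s : seq (A * B)) : V :=
  \sum_(p <- s) beta p.1 p.2.

(* Equality in the algebraic tensor product. *)
Definition same_tensor (s t : seq (A * B)) :=
  forall (V : lmodType R[i]) (beta : {bilinear A -> B -> V}),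
    tensor_sum beta s = tensor_sum beta t.

Definition projective_norm (s : seq (A * B)) : R :=
  inf [set \sum_(p <- t) complex.Re `|p.1| * complex.Re `|p.2|
      | t in [set t | same_tensor s t]].

(* T, with a (x) b := tau a b, is the completion of the algebraic tensor product
   of A and B for the projective norm, with its usual multiplication. *)
Definition is_projective_tensor_product (T : banachAlgType R[i])
    (tau : {bilinear A -> B -> T}) :=
  [/\ forall s, `|tensor_sum tau s| = (projective_norm s)%:C,
      dense (range (tensor_sum tau)) &
      forall a1 a2 b1 b2,
        tau a1 b1 ** tau a2 b2 = tau (a1 ** a2) (b1 ** b2)].

End ProjectiveTensorProduct.

(* Main.v *)
Require Import Defs.
From HB Require Import structures.
From mathcomp Require Import all_boot all_order all_algebra.
From mathcomp Require Import all_classical all_reals all_analysis.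
From mathcomp Require Import complex.
From mathcomp Require Import ring.

Set Implicit Arguments.
Unset Strict Implicit.
Unset Printing Implicit Defensive.

Import Order.TTheory GRing.Theory Num.Theory.
Import numFieldNormedType.Exports.

Local Open Scope classical_set_scope.
Local Open Scope ring_scope.
Local Open Scope complex_scope.

Local Open Scope banach_scope.

(** Let [C] be an approximately weakly amenable Banach algebra.  Every
    derivation [D] of [C] is a pointwise limit of the maps
    [a |-> a . x - x . a], and such a map has the value
    [x (a a) - x (a a) = 0] at the pair [(a, a)]; hence [D a a = 0] for all [a]
    ([approximately_inner_diag]).  Apply this to a derivation of rank one,
    [D t = delta t *: Phi] with [delta] and [Phi] in the dual of [C]: the
    product [delta t * Phi t] is zero for all [t], so [C] is the union of two
    kernels, and [delta] or [Phi] vanishes ([rank_one_derivation_eq0]).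

    The map [t |-> delta t *: Phi] is a derivation if and only if
    [delta (a b) Phi c = delta a Phi (b c) + delta b Phi (c a)] for all [a],
    [b] and [c].  Two families satisfy this identity: [delta = Phi] zero on all
    products, and [Phi] a character with [delta] a continuous point derivation
    at [Phi].  In the projective tensor product of [A] and [B] such functionals
    are made of functionals [f] on [A] and [g] on [B] through
    [(f (x) g) (a (x) b) = f a * g b] ([tensor_dual]); by density and continuity
    the identity has to be verified on elementary tensors only
    ([tensor_rank_one_eq0]).

    If [A] is not essential, the Hahn-Banach theorem gives a nonzero [f] in the
    dual of [A] that vanishes on products; with any nonzero [g] in the dual of
    [B], [delta = Phi = f (x) g] contradicts this vanishing.  If [d] is a nonzero
    continuous point derivation on [A] at [chi] and [psi] is a character of [B],
    then [delta = d (x) psi] and [Phi = chi (x) psi] contradict it.  The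
    functional [f (x) g] is bounded because characters of Banach algebras are
    contractive ([character_contractive]).  For [A (x) A] a point derivation at
    [chi] provides the second character, namely [chi] itself.

    The complex Hahn-Banach theorem is proved for graphs of functionals
    ([hahn_banach]).  In this form it gives both the separation of a point from
    a subspace and the functional [f (x) g], whose graph over the algebraic
    tensors is bounded by the definition of the projective norm. *)

(** * The real Hahn-Banach theorem *)

(** A functional defined on a subspace is encoded by its graph: the union of a
    chain of graphs is again a graph, so that Zorn's lemma applies without any
    choice of domains.  Single-valuedness is not part of the definition; it
    follows from domination by a norm or a sublinear map. *)
Definition linear_graph (K : nzRingType) (V : lmodType K)
    (G : set (V * K^o)) :=
  G !=set0 /\ forall k x y, G x -> G y -> G (k *: x + y).

Lemma linear_graph0 (K : nzRingType) (V : lmodType K) (G : set (V * K^o)) :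
  linear_graph G -> G 0.
Proof. by move=> [[x Gx] /(_ (-1) _ _ Gx Gx)]; rewrite scaleN1r addNr. Qed.

Section RealHahnBanach.
Variables (R : realType) (V : lmodType R) (p : V -> R).
Hypothesis p_subadditive : forall u v, p (u + v) <= p u + p v.
Hypothesis p_homogeneous : forall (k : R) v, 0 <= k -> p (k *: v) = k * p v.

Let dominated (G : set (V * R^o)) := forall x, G x -> x.2 <= p x.1.

(** The value [c] at [v] must lie above all [y.2 - p (y.1 - v)] and below all
    [p (x.1 + v) - x.2]; subadditivity of [p] separates these two sets, and
    homogeneity reduces a general multiple [k *: v] to [v] and [- v]. *)
Lemma dominated_one_step (G : set (V * R^o)) (v : V) :
  linear_graph G -> dominated G ->
  exists c : R, forall k x, G x -> x.2 + k * c <= p (x.1 + k *: v).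
Proof.
move=> lG dG; have [_ linG] := lG.
have sep x y : G x -> G y -> y.2 - p (y.1 - v) <= p (x.1 + v) - x.2.
  move=> Gx Gy; have := linG 1 _ _ Gx Gy; rewrite scale1r => /dG /= xy.
  rewrite lerBrDr addrAC lerBlDr addrC; apply: (le_trans xy).
  by rewrite -[x.1 + y.1]addr0 -(subrr v) addrACA.
pose L := [set y.2 - p (y.1 - v) | y in G].
have G0 := linear_graph0 lG.
have supL : has_ubound L.
  by exists (p (0 + v) - 0) => _ [y Gy <-]; exact: (sep 0 y G0 Gy).
exists (sup L) => k x Gx.
have Lc y : G y -> y.2 - p (y.1 - v) <= sup L.
  by move=> Gy; apply: ub_le_sup => //; exists y.
have cU y : G y -> sup L <= p (y.1 + v) - y.2.
  move=> Gy; apply: ge_sup; first by exists (0 - p (0 - v)), 0.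
  by move=> _ [z Gz <-]; exact: sep.
have scal m : G (m *: x) by have := linG m _ _ Gx G0; rewrite addr0.
have [k0|k0|->] := ltgtP k 0; last by rewrite mul0r scale0r !addr0 dG.
- have := Lc _ (scal (- k)^-1) => /=.
  have mk : 0 < - k by rewrite oppr_gt0.
  rewrite lerBlDr -lerBlDl => /(ler_wpM2l (ltW mk)).
  rewrite mulrBr -p_homogeneous ?(ltW mk)// scalerBr scalerA.
  rewrite mulfV ?gt_eqF// scale1r.
  by rewrite mulrA mulfV ?gt_eqF// mul1r mulNr opprK scaleNr opprK.
- have := cU _ (scal k^-1) => /=.
  rewrite lerBrDr => /(ler_wpM2l (ltW k0)).
  rewrite mulrDr -p_homogeneous ?(ltW k0)// scalerDr scalerA.
  rewrite mulfV ?gt_eqF// scale1r.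
  by rewrite mulrA mulfV ?gt_eqF// mul1r addrC.
Qed.

Theorem real_hahn_banach (G : set (V * R^o)) :
  linear_graph G -> dominated G ->
  exists2 f : {scalar V}, forall v, f v <= p v & forall x, G x -> f x.1 = x.2.
Proof.
move=> lG dG.
(* The empty graph is allowed because the empty chain has an empty union. *)
pose P H := H = set0 \/ [/\ linear_graph H, dominated H & G `<=` H].
have [|M [PM maxM]] := @Zorn_bigcup _ P.
  move=> F FP totF.
  have [[H FH Hn0]|allE] := pselect (exists2 H, F H & H !=set0); last first.
    left; apply/seteqP; split=> // x [H FH Hx].
    by case: allE; exists H => //; exists x.
  right; have good H' : F H' -> H' !=set0 ->
      [/\ linear_graph H', dominated H' & G `<=` H'].
    by move=> /FP[-> [//]|].
  have [lH dH GH] := good H FH Hn0; split.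
  - split; first by case: Hn0 => x Hx; exists x, H.
    move=> k x y [H1 F1 x1] [H2 F2 y2].
    have [s|s] := totF _ _ F1 F2.
      have [[_ l2] _ _] := good _ F2 (ex_intro _ y y2).
      by exists H2 => //; apply: l2 => //; exact: s.
    have [[_ l1] _ _] := good _ F1 (ex_intro _ x x1).
    by exists H1 => //; apply: l1 => //; exact: s.
  - move=> x [H1 F1 x1].
    by have [_ d1 _] := good _ F1 (ex_intro _ x x1); exact: d1.
  - by move=> x /GH Hx; exists H.
have {PM} [lM dM GM] : [/\ linear_graph M, dominated M & G `<=` M].
  case: PM => // M0; exfalso; apply: (maxM G); last by right; split.
  by rewrite M0; split=> //; case: lG => -[x Gx] _ /(_ x Gx).
have [_ linM] := lM; have M0 := linear_graph0 lM.
have total v : exists c, M (v, c).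
  have [c cP] := dominated_one_step v lM dM.
  pose N := [set x + k *: ((v, c) : V * R^o) | k in [set: R] & x in M].
  have MN : M `<=` N.
    by move=> x Mx; exists 0 => //; exists x => //; rewrite scale0r addr0.
  have [//|nMv] := pselect (M (v, c)); first by exists c.
  exfalso; apply: (maxM N).
    split=> // NM; apply: nMv; apply: NM; exists 1 => //; exists 0 => //.
    by rewrite scale1r add0r.
  right; split; last exact: subset_trans MN.
  - split; first by exists 0; exact: MN.
    move=> k _ _ [a _ [x Mx <-]] [b _ [y My <-]].
    exists (k * a + b) => //; exists (k *: x + y); first exact: linM.
    by rewrite scalerDr scalerA scalerDl addrACA.
  - by move=> _ [k _ [x Mx <-]]; exact: cP.
have p0 : p 0 = 0 by rewrite -(scale0r 0) p_homogeneous// mul0r.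
have uniq v c d : M (v, c) -> M (v, d) -> c = d.
  have le c' d' : M (v, c') -> M (v, d') -> c' <= d'.
    move=> Mc Md; have := linM (-1) _ _ Md Mc; rewrite scaleN1r => /dM /=.
    by rewrite addNr p0 addrC subr_le0.
  by move=> Mc Md; apply/eqP; rewrite eq_le !le.
have [f fM] := choice total.
have flin : scalar f.
  move=> k u v; apply: (uniq (k *: u + v)) => //.
  exact: (linM k (u, f u) (v, f v)).
pose F : {scalar V} := HB.pack f (GRing.isLinear.Build R V R *%R f flin).
exists F; first by move=> v; exact: (dM (v, f v)).
by move=> x Gx; apply: (uniq x.1) => //; rewrite -surjective_pairing; exact: GM.
Qed.

End RealHahnBanach.

(** * The complex Hahn-Banach theorem *)

(** The alias carries the real vector space structure of [V], which would
    otherwise compete with the complex one. *)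
Definition realification (R : rcfType) (V : lmodType R[i]) : Type := V.

Section Realification.
Variables (R : rcfType) (V : lmodType R[i]).

HB.instance Definition _ := GRing.Zmodule.copy (realification V) V.

Let rscale (k : R) (v : realification V) : realification V :=
  k%:C *: (v : V).

Let rscaleA a b v : rscale a (rscale b v) = rscale (a * b) v.
Proof. by rewrite /rscale scalerA -rmorphM. Qed.

Let rscale1 : left_id 1 rscale.
Proof. by move=> v; rewrite /rscale scale1r. Qed.

Let rscaleDr : right_distributive rscale +%R.
Proof. by move=> k u v; rewrite /rscale scalerDr. Qed.

Let rscaleDl v : {morph rscale^~ v : a b / a + b}.
Proof. by move=> a b; rewrite /rscale rmorphD scalerDl. Qed.

HB.instance Definition _ := GRing.Zmodule_isLmodule.Build R (realification V)
  rscaleA rscale1 rscaleDr rscaleDl.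

Lemma realification_scaleE (k : R) (v : realification V) :
  k *: v = k%:C *: (v : V) :> V.
Proof. by []. Qed.

End Realification.

Section ComplexHahnBanach.
Variables (R : realType) (V : normedModType R[i]).

(** The real part [u] of the functional is obtained from the real theorem, and
    [f v = u v - i u (i v)] is the only complex linear functional with this real
    part.  The bound on [u] passes to [f] by rotating [f v] to [`|f v|]. *)
Theorem hahn_banach (G : set (V * R[i]^o)) (M : R) : 0 <= M ->
  linear_graph G -> (forall x, G x -> `|x.2| <= M%:C * `|x.1|) ->
  exists f : dual V, forall x, G x -> f x.1 = x.2.
Proof.
move=> M0 lG dG; have [_ linG] := lG; have G0 := linear_graph0 lG.
pose p (v : realification V) : R := M * complex.Re `|v : V|.
pose GR : set (realification V * R^o) :=
  [set (x.1 : realification V, complex.Re x.2 : R^o) | x in G].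
have pE v : (p v)%:C = M%:C * `|v : V| by rewrite /p rmorphM /= Re_norm.
have pD u v : p (u + v) <= p u + p v.
  by rewrite /p -mulrDr ler_wpM2l// -lecR rmorphD /= !Re_norm ler_normD.
have pZ (k : R) v : 0 <= k -> p (k *: v) = k * p v.
  move=> k0; rewrite /p mulrCA; congr (_ * _); apply: complexI.
  rewrite rmorphM /= !Re_norm realification_scaleE normrZ ger0_norm// lecR//.
have lGR : linear_graph GR.
  split; first by case: lG => -[x Gx] _; exists (x.1, complex.Re x.2), x.
  move=> k _ _ [x Gx <-] [y Gy <-]; exists (k%:C *: x + y); first exact: linG.
  congr (_, _); rewrite /= raddfD /=; congr (_ + _).
  by case: x.2 => a b /=; rewrite mul0r subr0.
have dGR x : GR x -> x.2 <= p x.1.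
  move=> [y Gy <-] /=; rewrite -lecR pE; apply: le_trans (dG _ Gy).
  apply: le_trans (normc_ge_Re y.2); rewrite lecR ler_norm.
  by [].
have [u up uG] := real_hahn_banach pD pZ lGR dGR.
have uD (x y : V) : u (x + y) = u x + u y by exact: (linearD u).
have uZ (k : R) (v : V) : u (k%:C *: v) = k * u v by exact: (scalarZ u).
pose f (v : V) : R[i]^o := u v +i* - u ('i%C *: v).
have flin : linear f.
  move=> [a b] x y; rewrite /f.
  have -> : (a +i* b) *: x = a%:C *: x + b%:C *: ('i%C *: x).
    rewrite scalerA -scalerDl; congr (_ *: _); apply/eqP; rewrite eq_complex /=.
    by apply/andP; split; apply/eqP; ring.
  have -> : 'i%C *: (a%:C *: x + b%:C *: ('i%C *: x) + y) =
      a%:C *: ('i%C *: x) + (- b)%:C *: x + 'i%C *: y.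
    rewrite !scalerDr; congr (_ + _ + _); rewrite !scalerA; congr (_ *: _).
      by rewrite mulrC.
    by apply/eqP; rewrite eq_complex /=; apply/andP; split; apply/eqP; ring.
  rewrite !uD !uZ; apply/eqP; rewrite eq_complex /=.
  by apply/andP; split; apply/eqP; ring.
have fbound v : `|f v| <= M%:C * `|v|.
  have [->|fv0] := eqVneq (f v) 0; first by rewrite normr0 mulr_ge0 ?lecR.
  pose t : R[i] := `|f v| / f v.
  have t1 : `|t| = 1 by rewrite normf_div normr_id divff ?normr_eq0.
  have ftv : f (t *: v) = `|f v|.
    have := flin t v 0; rewrite addr0 => ->.
    have -> : f 0 = 0.
      by have := flin (-1) 0 0; rewrite scaler0 addr0 scaleN1r addNr.
    by rewrite addr0 [LHS]mulfVK.
  have <- : `|t *: v| = `|v| by rewrite normrZ t1 mul1r.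
  by rewrite -ftv -[f _]RRe_real ?ftv ?normr_real// -ftv /= -pE lecR.
have fP : f \in @dual_pred R V by rewrite inE; split => //; exists M.
exists (Dual fP) => x Gx; rewrite /= /f.
have := uG _ (ex_intro2 _ _ x Gx erefl) => /= ->.
have Gix : G ('i%C *: x) by have := linG 'i%C _ _ Gx G0; rewrite addr0.
have := uG _ (ex_intro2 _ _ _ Gix erefl) => /= ->.
by case: x.2 => a b /=; congr (_ +i* _); ring.
Qed.
End ComplexHahnBanach.

(** * Bounded functionals *)

Section DualFacts.
Variables (R : realType) (V : normedModType R[i]).

Lemma dual_continuous (f : dual V) : continuous (f : V -> R[i]^o).
Proof.
apply: bounded_linear_continuous; apply/linear_boundedP.
near=> r => x; apply: le_trans (le_dual_norm f x) _.
rewrite ler_wpM2r//; near: r; apply: nbhs_pinfty_ge.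
by rewrite realE lecR dual_norm_ge0.
Unshelve. all: by end_near. Qed.

Lemma dualD (f g : dual V) v : (f + g) v = f v + g v.
Proof. by []. Qed.

Lemma dualB (f g : dual V) v : (f - g) v = f v - g v.
Proof. by []. Qed.

Lemma dualZ k (f : dual V) v : (k *: f) v = k * f v.
Proof. by []. Qed.

Lemma bounded_dual (f : {scalar V}) (M : R) :
  (forall v, `|f v| <= M%:C * `|v|) -> exists g : dual V, forall v, g v = f v.
Proof.
move=> fM; have fP : (f : V -> R[i]^o) \in @dual_pred R V.
  by rewrite inE; split; [move=> k x y; exact: linearP|exists M].
by exists (Dual fP).
Qed.

Lemma continuous_dual (f : {scalar V}) :
  continuous (f : V -> R[i]^o) -> exists g : dual V, forall v, g v = f v.
Proof.
have flin : linear (f : V -> R[i]^o) by move=> k x y; exact: linearP.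
pose F : {linear V -> R[i]^o} := HB.pack (f : V -> R[i]^o)
  (GRing.isLinear.Build R[i] V R[i]^o *:%R (f : V -> R[i]^o) flin).
move=> /(linear_bounded_continuous F) /linear_boundedP.
move=> /pinfty_ex_gt0[r r0 fr]; apply: (@bounded_dual f (complex.Re r)) => v.
by rewrite RRe_real ?gtr0_real//; exact: fr.
Qed.

(** A vector [v] at distance at least [e] from [W] makes [w + k *: v |-> k] a
    functional bounded by [e^-1]; it extends to the whole space. *)
Lemma nondense_annihilator (W : set V) :
  W 0 -> (forall k x y, W x -> W y -> W (k *: x + y)) -> ~ dense W ->
  exists f : dual V, (exists v, f v != 0) /\ forall w, W w -> f w = 0.
Proof.
move=> W0 Wlin /denseNE[U [[v [Uo Uv]] UW]].
have /nbhs_normP[e /= e0 eU] : nbhs v U by exact: open_nbhs_nbhs.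
have far w : W w -> e <= `|v + w|.
  move=> Ww; rewrite real_leNgt ?normr_real ?gtr0_real//; apply/negP => lt_e.
  have : (U `&` W) (- w).
    split; first by apply: eU; rewrite /= opprK.
    by have := Wlin (-1) _ _ Ww W0; rewrite addr0 scaleN1r.
  by rewrite UW.
pose G : set (V * R[i]^o) :=
  [set x | exists2 w, W w & x.1 = w + x.2 *: v].
have [||x [w Ww wx]|f fG] := @hahn_banach R V G (complex.Re e^-1).
- by rewrite -lecR RRe_real ?rpredV ?gtr0_real// invr_ge0 ltW.
- split; first by exists 0; exists 0; rewrite // scale0r addr0.
  move=> k x y [w Ww xw] [z Wz yz]; exists (k *: w + z); first exact: Wlin.
  by rewrite /= xw yz scalerDr scalerDl scalerA addrACA.
- rewrite RRe_real ?rpredV ?gtr0_real// ler_pdivlMl// wx.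
  have [->|k0] := eqVneq x.2 0; first by rewrite normr0 mulr0.
  have -> : w + x.2 *: v = x.2 *: (v + x.2^-1 *: w).
    by rewrite scalerDr scalerA mulfV// scale1r addrC.
  rewrite normrZ mulrC ler_wpM2l// far//.
  by have := Wlin x.2^-1 _ _ Ww W0; rewrite addr0.
exists f; split.
  exists v; have -> : f v = 1.
    by apply: (fG (v, 1)); exists 0; rewrite //= scale1r add0r.
  exact: oner_neq0.
by move=> w Ww; apply: (fG (w, 0)); exists w; rewrite //= scale0r addr0.
Qed.

Lemma nonzero_dual (v : V) : v != 0 -> exists f : dual V, exists w, f w != 0.
Proof.
move=> v0; have [ | | |f [f0 _]] := @nondense_annihilator [set 0].
- by [].
- by move=> k x y -> ->; rewrite scaler0 addr0.
- move=> /(_ (~` [set 0])) [||w [w0]] //.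
    by exists v; apply/eqP.
  exact/closed_openC/accessible_closed_set1/hausdorff_accessible/norm_hausdorff.
- by exists f.
Qed.

End DualFacts.

(** * Functionals on the projective tensor product *)

Section DualProd.
Variables (R : realType) (A B : banachAlgType R[i]) (f : dual A) (g : dual B).

Definition dual_prod (a : A) (b : B) : R[i]^o := f a * g b.

Lemma dual_prod_bilinear : bilinear_for *:%R *:%R dual_prod.
Proof.
split=> [b|a] k x y; rewrite /dual_prod linearP /= /GRing.scale /=; ring.
Qed.

HB.instance Definition _ :=
  bilinear_isBilinear.Build R[i] A B R[i]^o *:%R *:%R dual_prod
    dual_prod_bilinear.

(** The left-hand side depends only on the tensor that [s] represents, so the
    triangle inequality may be applied to each of its representatives.  Adding 1
    to the constant makes it positive, and division by it is then possible. *)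
Lemma le_tensor_sum_dual_prod s :
  complex.Re `|tensor_sum dual_prod s| <=
    (dual_norm f * dual_norm g + 1) * projective_norm s.
Proof.
set c := _ + 1.
have c0 : 0 < c by rewrite ltr_wpDl// mulr_ge0 ?dual_norm_ge0.
rewrite -ler_pdivrMl//; apply: lb_le_inf; first by eexists; exists s.
move=> _ [t st <-]; rewrite ler_pdivrMl// (st _ dual_prod).
rewrite -lecR Re_norm rmorphM rmorph_sum /= mulr_sumr.
apply: le_trans (ler_norm_sum _ _ _) _; apply: ler_sum => -[a b] _ /=.
rewrite rmorphM /= !Re_norm normrM.
apply: le_trans (ler_pM _ _ (le_dual_norm f a) (le_dual_norm g b)) _ => //.
rewrite mulrACA ler_wpM2r// ?mulr_ge0// -rmorphM lecR.
by rewrite lerDl.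
Qed.

End DualProd.

Section TensorProduct.
Variables (R : realType) (A B T : banachAlgType R[i]).
Variable tau : {bilinear A -> B -> T}.
Hypothesis tauP : is_projective_tensor_product tau.

Lemma tensor_sum_cat (V : lmodType R[i]) (beta : A -> B -> V) s t :
  tensor_sum beta (s ++ t) = tensor_sum beta s + tensor_sum beta t.
Proof. exact: big_cat. Qed.

Lemma tensor_sum_scale (V : lmodType R[i]) (beta : {bilinear A -> B -> V}) k s :
  tensor_sum beta [seq (k *: p.1, p.2) | p <- s] = k *: tensor_sum beta s.
Proof.
rewrite /tensor_sum big_map scaler_sumr; apply: eq_bigr => p _ /=.
by rewrite linearZl_LR.
Qed.

(** The functional [f (x) g], first on the algebraic tensors and then extended
    to their completion by the Hahn-Banach theorem rather than by uniform
    continuity. *)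
Lemma tensor_dual (f : dual A) (g : dual B) :
  exists F : dual T, forall a b, F (tau a b) = f a * g b.
Proof.
have [normE _ _] := tauP.
pose G : set (T * R[i]^o) :=
  range (fun s => (tensor_sum tau s, tensor_sum (dual_prod f g) s)).
have [||_ [s _ <-]|F FG] := @hahn_banach R T G (dual_norm f * dual_norm g + 1).
- by rewrite addr_ge0// mulr_ge0 ?dual_norm_ge0.
- split; first by eexists; exists [::].
  move=> k _ _ [s _ <-] [t _ <-].
  exists ([seq (k *: p.1, p.2) | p <- s] ++ t) => //.
  by rewrite !tensor_sum_cat !tensor_sum_scale.
- rewrite /= normE -(Re_norm (tensor_sum _ _ : R[i]^o)) -rmorphM lecR.
  exact: le_tensor_sum_dual_prod.
exists F => a b; apply: (FG (tau a b, f a * g b)); exists [:: (a, b)] => //.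
by rewrite /tensor_sum !big_seq1.
Qed.

Lemma tensor_dual_ext (F G : dual T) :
  (forall a b, F (tau a b) = G (tau a b)) -> F = G.
Proof.
move=> FG; have [_ dT _] := tauP.
apply/eqP; rewrite -subr_eq0; apply/eqP; set H := F - G.
have H0 a b : H (tau a b) = 0 by rewrite dualB FG subrr.
clearbody H.
apply/val_inj/funext => t; apply/eqP/negPn/negP => /= Ht.
have [||t' [+ [s _ st]]] := dT (H @^-1` (~` [set 0])).
- by exists t; apply/eqP.
- apply: open_comp => [x _|]; first exact: (@dual_continuous _ _ H x).
  exact/closed_openC/accessible_closed_set1/hausdorff_accessible/norm_hausdorff.
- move=> /= Ht'; apply: Ht'; rewrite -st /tensor_sum linear_sum big1// => p _.
  exact: H0.
Qed.

End TensorProduct.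

(** * Rank-one derivations *)

Section ApproximatelyInner.
Variables (R : realType) (C : banachAlgType R[i]).

(** Evaluation at [(a, a)] annihilates all inner derivations, and it is
    continuous for convergence in norm at [a]. *)
Lemma approximately_inner_diag (D : {linear C -> dual C}) :
  approximately_inner D -> forall a, D a a = 0.
Proof.
move=> [I [le [x [[[i0] lexx ltr le2] Dlim]]]] a.
have FF : ProperFilter (tails le).
  apply: filter_from_proper; last by move=> i _; exists i; exact: lexx.
  apply: filter_from_filter; first by exists i0.
  move=> i j _ _; have [k [ik jk]] := le2 i j; exists k => // l kl.
  by split; [exact: ltr kl|exact: ltr kl].
apply/eqP; rewrite -normr_le0; apply/ler_addgt0Pl => e e0; rewrite addr0.
have /cvgrPdist_lt /(_ (e / (1 + `|a|))) := Dlim a.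
move=> [|i _ /(_ i (lexx i)) /= Di].
  by rewrite divr_gt0// ltr_wpDr.
set y := lact _ _ - _ in Di.
have ya : y a = 0 by rewrite dualB subrr.
have -> : D a a = (D a - y) a by rewrite dualB ya subr0.
apply: le_trans (le_dual_norm _ _) _.
have /ler_wpM2r : (dual_norm (D a - y))%:C <= e / (1 + `|a|) by exact: ltW.
move=> /(_ `|a| (normr_ge0 a)) /le_trans; apply.
by rewrite mulrAC ler_pdivrMr ?ltr_wpDr// ler_pM2l// lerDr.
Qed.

Section RankOne.
Variables delta Phi : dual C.

Definition rank_one (t : C) : dual C := (delta t : R[i]) *: Phi.

Lemma rank_one_linear : linear rank_one.
Proof.
by move=> k x y; rewrite /rank_one linearP scalerDl scalerA.
Qed.

HB.instance Definition _ :=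
  GRing.isLinear.Build R[i] C (dual C) *:%R rank_one rank_one_linear.

Lemma rank_one_continuous : continuous rank_one.
Proof.
by move=> t; apply: cvgZr_tmp; exact: dual_continuous.
Qed.

(** The diagonal values [delta t * Phi t] vanish; polarization at [s + t] then
    gives [delta s * Phi t + delta t * Phi s = 0], and [Phi s = 0] as soon as
    [delta s] is nonzero. *)
Lemma rank_one_derivation_eq0 : approximately_weakly_amenable C ->
  (forall a b c,
     delta (a ** b) * Phi c =
     delta a * Phi (b ** c) + delta b * Phi (c ** a)) ->
  forall s t, delta s * Phi t = 0.
Proof.
move=> awa dP.
have /approximately_inner_diag diag0 : approximately_inner rank_one.
  apply: awa; split; first exact: rank_one_continuous.
  (* At [c], the Leibniz rule for [rank_one] is the identity [dP]. *)
  by move=> a b; apply/val_inj/funext => c; exact: dP.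
have {}diag0 t : delta t * Phi t = 0 by exact: diag0.
move=> s t.
have := diag0 (s + t); rewrite !linearD /= mulrDl !mulrDr !diag0 addr0 add0r.
have [->|ds] := eqVneq (delta s) 0; first by rewrite mul0r.
have /eqP := diag0 s; rewrite mulf_eq0 (negPf ds) => /eqP ->.
by rewrite mulr0 addr0.
Qed.

End RankOne.
End ApproximatelyInner.

Section TensorRankOne.
Variables (R : realType) (A B T : banachAlgType R[i]).
Variable tau : {bilinear A -> B -> T}.
Hypothesis tauP : is_projective_tensor_product tau.

(** For two fixed arguments, both sides of the derivation identity are bounded
    functionals of the third one, so they agree everywhere once they agree on
    elementary tensors; this is used for each argument in turn. *)
Lemma tensor_rank_one_eq0 (f f' : dual A) (g g' : dual B) :
  approximately_weakly_amenable T ->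
  (forall a1 a2 a3 b1 b2 b3,
     f (a1 ** a2) * g (b1 ** b2) * (f' a3 * g' b3) =
     f a1 * g b1 * (f' (a2 ** a3) * g' (b2 ** b3)) +
     f a2 * g b2 * (f' (a3 ** a1) * g' (b3 ** b1))) ->
  forall a b a' b', f a * g b * (f' a' * g' b') = 0.
Proof.
move=> awa dP.
have [delta deltaE] := tensor_dual tauP f g.
have [Phi PhiE] := tensor_dual tauP f' g'.
have [_ _ tauM] := tauP.
have ext (H K : dual T) : (forall a b, H (tau a b) = K (tau a b)) ->
    forall t, H t = K t.
  by move=> /(tensor_dual_ext tauP) ->.
have dPT a b c :
    delta (a ** b) * Phi c = delta a * Phi (b ** c) + delta b * Phi (c ** a).
  have := ext (Phi c *: lact b delta)
    (Phi (b ** c) *: delta + delta b *: ract Phi c) _ a.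
  rewrite dualD !dualZ mulrC [_ * delta a]mulrC; apply=> a1 b1 {a}.
  rewrite dualD !dualZ [LHS]mulrC [_ * delta (tau _ _)]mulrC.
  have := ext (Phi c *: ract delta (tau a1 b1))
    (delta (tau a1 b1) *: lact c Phi + Phi (c ** tau a1 b1) *: delta) _ b.
  rewrite dualD !dualZ mulrC [_ * delta b]mulrC; apply=> a2 b2 {b}.
  rewrite dualD !dualZ [LHS]mulrC [_ * delta (tau a2 _)]mulrC.
  have := ext (delta (tau a1 b1 ** tau a2 b2) *: Phi)
    (delta (tau a1 b1) *: ract Phi (tau a2 b2) +
     delta (tau a2 b2) *: lact (tau a1 b1) Phi) _ c.
  rewrite dualD !dualZ; apply=> a3 b3 {c}.
  by rewrite dualD !dualZ /= !tauM !deltaE !PhiE; exact: dP.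
by move=> a b a' b'; rewrite -deltaE -PhiE (rank_one_derivation_eq0 awa dPT).
Qed.
End TensorRankOne.

(** * Continuity of characters *)

Section Characters.
Variables (R : realType) (A : banachAlgType R[i]).

(** The solution is the sum of the powers of [a], obtained here as the limit of
    the iterates of the contraction [b |-> a + a ** b]. *)
Lemma quasi_inverse (a : A) : `|a| < 1 -> exists b, b = a + a ** b.
Proof.
set q := `|a| => q1.
have q0 : 0 <= q := normr_ge0 a.
pose u n := iter n (fun b => a + a ** b) 0.
have du n : `|u n.+1 - u n| <= q ^+ n.
  elim: n => [|n IH].
    by rewrite /u /= linear0r addr0 subr0 expr0 ltW.
  have -> : u n.+2 - u n.+1 = a ** (u n.+1 - u n).
    by rewrite linearBr /= opprD addrACA subrr add0r.
  rewrite (le_trans (ler_norm_amul _ _))// exprS ler_wpM2l//.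
(* Multiplying by [1 - q] turns the geometric bound into a telescoping one. *)
have dist n m : (1 - q) * `|u n - u (n + m)%N| <= q ^+ n - q ^+ (n + m).
  have q1' : 0 <= 1 - q by rewrite subr_ge0 ltW.
  elim: m => [|m IH]; first by rewrite addn0 !subrr normr0 mulr0.
  rewrite addnS.
  have -> : u n - u (n + m).+1 =
      (u n - u (n + m)%N) - (u (n + m).+1 - u (n + m)%N).
    by rewrite opprB addrA subrK.
  apply: le_trans (ler_wpM2l q1' (ler_normB _ _)) _.
  rewrite mulrDr.
  have -> : q ^+ n - q ^+ (n + m).+1 =
      (q ^+ n - q ^+ (n + m)) + (1 - q) * q ^+ (n + m) by rewrite exprS; ring.
  by rewrite lerD// ler_wpM2l.
have ucvg : cvgn u.
  apply/cauchy_cvgP/cauchyP => e e0.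
  have rq : complex.Re q < 1 by rewrite -ltcR Re_norm.
  have : `|complex.Re q| < 1 by rewrite ger0_norm// -lecR Re_norm.
  move=> /cvg_expr /cvgrPdist_lt /(_ (complex.Re (e * (1 - q)))).
  have e'0 : 0 < e * (1 - q) by rewrite mulr_gt0 ?subr_gt0.
  move=> [|n _ /(_ n (leqnn n)) /=].
    by rewrite -ltcR RRe_real ?gtr0_real.
  rewrite sub0r normrN -ltcR RRe_real ?gtr0_real// => qn.
  exists (u n); exists n => // k /= nk; rewrite -ball_normE /=.
  rewrite -(ltr_pM2r (x := 1 - q)) ?subr_gt0// mulrC.
  rewrite -(subnKC nk) (le_lt_trans (dist _ _))// (le_lt_trans _ qn)//.
  rewrite normrX (ger0_norm (x := complex.Re q)) -?lecR ?Re_norm//.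
  by rewrite rmorphXn /= Re_norm lerBlDr lerDl exprn_ge0.
have mul_cont : continuous (amul a : A -> A).
  pose L : {linear A -> A} := HB.pack (amul a : A -> A)
    (GRing.isLinear.Build R[i] A A *:%R (amul a) (amul_linearr a)).
  apply: (@bounded_linear_continuous _ _ _ L); apply/linear_boundedP.
  near=> r => x; apply: le_trans (ler_norm_amul a x) _.
  rewrite ler_wpM2r//; near: r; apply: nbhs_pinfty_ge; exact: normr_real.
exists (lim (u @ \oo)).
have ucvgS : u n.+1 @[n --> \oo] --> lim (u @ \oo) by rewrite cvg_shiftS.
apply: (cvg_unique _ ucvgS) => //.
apply: cvgD; first exact: cvg_cst.
exact: (cvg_comp _ _ ucvg (mul_cont _)).
Unshelve. all: by end_near. Qed.

(** If [`|a| < `|phi a|], then [a / phi a] has norm less than one, and applying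
    [phi] to [b = a / phi a + (a / phi a) ** b] gives [phi b = 1 + phi b]. *)
Lemma character_contractive (phi : {scalar A}) :
  (forall a b, phi (a ** b) = phi a * phi b) -> forall a, `|phi a| <= `|a|.
Proof.
move=> phiM a; rewrite real_leNgt ?normr_real//; apply/negP => lt_a.
have p0 : phi a != 0 by rewrite -normr_gt0 (le_lt_trans _ lt_a).
have [|b bE] := @quasi_inverse ((phi a)^-1 *: a).
  by rewrite normrZ normfV ltr_pdivrMl ?normr_gt0// mulr1.
have /eqP := congr1 phi bE.
rewrite linearD /= phiM scalarZ mulVf// mul1r.
by rewrite -subr_eq0 opprD addrCA subrr addr0 oppr_eq0 oner_eq0.
Qed.

Lemma character_dual (phi : {scalar A}) :
  (forall a b, phi (a ** b) = phi a * phi b) ->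
  exists f : dual A, forall a, f a = phi a.
Proof.
move=> /character_contractive phi1; apply: (@bounded_dual _ _ phi 1) => a.
by rewrite mul1r.
Qed.

End Characters.

(** * Essentiality and point derivations *)

Section Main.
Variables (R : realType).

Lemma square0 (A : banachAlgType R[i]) : @square R A 0.
Proof. by exists 0, (fun=> 0), (fun=> 0), (fun=> 0); rewrite big_ord0. Qed.

Lemma nonessential_dual (A : banachAlgType R[i]) : ~ essential A ->
  exists f : dual A, (exists a, f a != 0) /\ forall a b, f (a ** b) = 0.
Proof.
move=> nessA; have [||//|f [f0 fsq]] := @nondense_annihilator _ _ (@square R A).
- exact: square0.
- move=> k _ _ [n [c [a [b ->]]]] [m [d [a' [b' ->]]]].
  pose glue (T : Type) (u : 'I_n -> T) (v : 'I_m -> T) (i : 'I_(n + m)%N) :=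
    match fintype.split i with inl j => u j | inr j => v j end.
  exists (n + m)%N, (glue _ (fun i => k * c i) d), (glue _ a a'), (glue _ b b').
  rewrite big_split_ord /= scaler_sumr; congr (_ + _).
    apply: eq_bigr => i _; rewrite /glue.
    by rewrite (unsplitK (inl i : 'I_n + 'I_m)) scalerA.
  apply: eq_bigr => i _; rewrite /glue.
  by rewrite (unsplitK (inr i : 'I_n + 'I_m)).
exists f; split=> // a b; apply: fsq.
exists 1%N, (fun=> 1), (fun=> a), (fun=> b).
by rewrite big_ord1 scale1r.
Qed.

Section Tensor.
Variables (A B T : banachAlgType R[i]) (tau : {bilinear A -> B -> T}).
Hypotheses (tauP : is_projective_tensor_product tau)
  (awaT : approximately_weakly_amenable T).

Lemma tensor_essential :
  (exists a : A, a != 0) -> (exists b : B, b != 0) ->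
  essential A /\ essential B.
Proof.
move=> [a0 /nonzero_dual[f0 [a f0a]]] [b0 /nonzero_dual[g0 [b g0b]]].
split; apply: contrapT => /nonessential_dual.
- move=> [f [[a' fa'] fM]].
  have P : f a' * g0 b * (f a' * g0 b) != 0 by rewrite !mulf_neq0.
  move/eqP: P; apply; apply: (tensor_rank_one_eq0 tauP awaT) => *.
  by rewrite !fM !(mul0r, mulr0) addr0.
- move=> [g [[b' gb'] gM]].
  have P : f0 a * g b' * (f0 a * g b') != 0 by rewrite !mulf_neq0.
  move/eqP: P; apply; apply: (tensor_rank_one_eq0 tauP awaT) => *.
  by rewrite !gM !(mul0r, mulr0) addr0.
Qed.

Lemma tensor_no_point_derivation (phi : {scalar A}) (psi : {scalar B}) :
  character phi -> character psi ->
  no_nonzero_continuous_point_derivation A /\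
  no_nonzero_continuous_point_derivation B.
Proof.
move=> [[a0 phi0] phiM] [[b0 psi0] psiM].
have [f fE] := character_dual phiM; have [g gE] := character_dual psiM.
split=> -[chi [d [[[c0 chi0] chiM] dM /continuous_dual[e eE] [c dc]]]].
- have [h hE] := character_dual chiM.
  have P : e c * g b0 * (h c0 * g b0) != 0.
    by rewrite !mulf_neq0// ?eE ?gE ?hE.
  move/eqP: P; apply; apply: (tensor_rank_one_eq0 tauP awaT) => *.
  by rewrite !eE !hE !gE dM !chiM !psiM; ring.
- have [h hE] := character_dual chiM.
  have P : f a0 * e c * (f a0 * h c0) != 0.
    by rewrite !mulf_neq0// ?eE ?fE ?hE.
  move/eqP: P; apply; apply: (tensor_rank_one_eq0 tauP awaT) => *.
  by rewrite !eE !hE !fE dM !chiM !phiM; ring.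
Qed.

End Tensor.
End Main.

Theorem theorem2p4 (R : realType) (A B : banachAlgType R[i]) :
  (forall (T : banachAlgType R[i]) (tau : {bilinear A -> B -> T}),
    is_projective_tensor_product tau ->
    approximately_weakly_amenable T ->
    ((exists a : A, a != 0) -> (exists b : B, b != 0) ->
       essential A /\ essential B) /\
    (forall (phi : {scalar A}) (psi : {scalar B}),
       character phi -> character psi ->
       no_nonzero_continuous_point_derivation A /\ no_nonzero_continuous_point_derivation B)) /\
  (forall (S : banachAlgType R[i]) (sigma : {bilinear A -> A -> S}),
    is_projective_tensor_product sigma ->
    approximately_weakly_amenable S ->
    essential A /\ no_nonzero_continuous_point_derivation A).
Proof.
split=> [T tau tauP awaT|S sigma sigmaP awaS].
  by split; [exact: tensor_essential tauP awaT|
    exact: tensor_no_point_derivation tauP awaT].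
split.
  have [[a a0]|A0] := pselect (exists a : A, a != 0).
    have An0 : exists a : A, a != 0 by exists a.
    by have [] := tensor_essential sigmaP awaS An0 An0.
  (* In the zero algebra every nonempty set meets the square, which is {0}. *)
  move=> U [x Ux] _; exists x; split=> //.
  have -> : x = 0 by apply/eqP/negPn/negP => x0; apply: A0; exists x.
  exact: square0.
move=> [phi [d [phiP dP dc d0]]].
have [+ _] := tensor_no_point_derivation sigmaP awaS phiP phiP.
by apply; exists phi, d; split.
Qed.
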